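(* Let $A$ and $B$ be two nonempty finite abelian subsets of a right-ordered group $G$ with $\max(A)<\min(B)$, $\max(A^{2})\leq\min(B^{2})$, $|A|\geq 4$, and $|B|\geq 3$. If $$\left|(A\cup B)^{2}\right|=3|A\cup B|-3,$$ then $\langle A\cup B\rangle$ is an abelian subgroup of $G$.
   Context: A right-ordered group is a group $G$ with a total order $\leq$ such that $x\leq y$ implies $xz\leq yz$ for all $x,y,z\in G$; $\max$ and $\min$ of finite subsets are taken with respect to this order. A subset $S$ of $G$ is called abelian if the subgroup $\langle S\rangle$ generated by $S$ is abelian. $S^{2}=\{s_{1}s_{2}: s_{1},s_{2}\in S\}$. *)

(* Defs.v *)
From HB Require Import structures.
From mathcomp Require Import all_boot all_order finmap.
From mathcomp Require Import boolp classical_sets.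

Set Implicit Arguments.
Unset Strict Implicit.
Unset Printing Implicit Defensive.

Import Order.TTheory.

Local Open Scope group_scope.
Local Open Scope classical_set_scope.
Local Open Scope order_scope.
Local Open Scope fset_scope.

HB.mixin Record isRightOrdered (d : Order.disp_t) G
    of Group G & Order.Total d G := {
  lemulg2r : forall x y z : G, (x <= y)%O -> (x * z <= y * z)%O
}.

#[short(type="rightOrderedGroupType")]
HB.structure Definition RightOrderedGroup (d : Order.disp_t) :=
  {G of Group G & Order.Total d G & isRightOrdered d G}.

Section Generated.
Variable G : groupType.

Definition generated (S : set G) : set G :=
  smallest [set H : set G | group_closed (mem H)] S.

Definition abelian_subgroup (H : set G) : Prop :=
  group_closed (mem H) /\ (forall x y, H x -> H y -> commute x y).

Definition abelian_subset (S : set G) : Prop :=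
  abelian_subgroup (generated S).

Definition fset_sqr (A : {fset G}) : {fset G} :=
  [fset x * y | x in A, y in A].

Lemma generated_group_closed (S : set G) : group_closed (mem (generated S)).
Proof.
split=> [|x y /set_mem xS /set_mem yS]; apply/mem_set => H [[H1 HF] SH].
  exact: set_mem.
by apply/set_mem/HF; apply/mem_set; [apply: xS|apply: yS].
Qed.

End Generated.

Section MinMax.
Variables (d : Order.disp_t) (G : rightOrderedGroupType d).
Implicit Types (A : {fset G}) (x : G).

(* The value 1 on the empty set is a dummy. *)
Definition fset_min A : G := head 1 (sort <=%O (enum_fset A)).
Definition fset_max A : G := last 1 (sort <=%O (enum_fset A)).

Lemma fset_minP A x : A != fset0 ->
  fset_min A = x <-> x \in A /\ (forall y, y \in A -> x <= y).
Proof.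
move=> A0; have inA y : (y \in A) = (y \in sort <=%O (enum_fset A)).
  by rewrite mem_sort.
have {}A0 : sort <=%O (enum_fset A) != [::].
  by case/fset0Pn: A0 => y; rewrite inA; case: sort.
rewrite /fset_min; have := sort_le_sorted (enum_fset A).
case: sort A0 inA => [//|a s] _ inA /=.
rewrite (path_sortedE le_trans) => /andP[/allP le_as _].
have le_a y : y \in A -> a <= y.
  by rewrite inA inE => /predU1P[->//|/le_as].
have aA : a \in A by rewrite inA mem_head.
split=> [<-//|[xA le_x]]; apply/le_anti.
by rewrite le_a //= le_x.
Qed.

Lemma fset_maxP A x : A != fset0 ->
  fset_max A = x <-> x \in A /\ (forall y, y \in A -> y <= x).
Proof.
move=> A0; have inA y : (y \in A) = (y \in sort <=%O (enum_fset A)).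
  by rewrite mem_sort.
have {}A0 : sort <=%O (enum_fset A) != [::].
  by case/fset0Pn: A0 => y; rewrite inA; case: sort.
rewrite /fset_max; have := sort_le_sorted (enum_fset A).
case/lastP: (sort _ _) A0 inA => [//|s a] _ inA.
rewrite last_rcons -rev_sorted rev_rcons /=.
rewrite (path_sortedE ge_trans) => /andP[/allP le_sa _].
have le_a y : y \in A -> y <= a.
  rewrite inA mem_rcons inE => /predU1P[->//|ys].
  by apply: le_sa; rewrite mem_rev.
have aA : a \in A by rewrite inA mem_rcons mem_head.
split=> [<-//|[xA le_x]]; apply/le_anti.
by rewrite le_a //= le_x.
Qed.

End MinMax.

(* Main.v *)
(* Suppose that A and B do not commute, and split A into the part A1 centralizing
   B and the rest A0; similarly for B. Then (A u B)^2 contains, besides A^2 u B^2,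
   the set W = A0 B0 u B0 A0, the translate a0 B1 of B1 by the largest element of
   A0 and the translate b0 A1 of A1 by the least element of B0, all disjoint.
   As in any right-ordered group |XY| >= |X| + |Y| - 1, this already accounts for
   3|A u B| - 4 or more elements, so that every estimate must be nearly sharp.
   If |XY| = |X| + |Y| - 1, then Y decomposes into chains under left translation
   by a quotient x^-1 x' of elements of X: this makes A or B a progression, and
   it puts A0 and B0 in single cosets of the center when |W| = |A0| + |B0| - 1.
   The cases |A0| = 1 and |B0| = 1, and the case where A^2 meets B^2, that is
   max(A)^2 = min(B)^2, are excluded separately, the last two by studying the
   action by conjugation of an element of one set on the progression. *)
Require Import Defs.
From mathcomp Require Import all_boot all_order finmap zify.
From mathcomp Require Import boolp classical_sets.

Local Open Scope classical_set_scope.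
Local Open Scope fset_scope.

Section RightOrderedGroup.
Set Implicit Arguments.
Unset Strict Implicit.
Import Order.TTheory.
Local Open Scope group_scope.
Local Open Scope order_scope.
Local Open Scope fset_scope.
Variables (d : Order.disp_t) (G : rightOrderedGroupType d).
Implicit Types (S T X Y A B : {fset G}) (x y z u g : G).

(** * Order and powers in a right-ordered group *)

Lemma ler_mulg2r z x y : (x * z <= y * z) = (x <= y).
Proof.
apply/idP/idP => [|/lemulg2r-> //].
by move=> /(@lemulg2r _ _ _ _ z^-1); rewrite !mulgK.
Qed.

Lemma ltr_mulg2r z x y : (x * z < y * z) = (x < y).
Proof. by rewrite !ltNge ler_mulg2r. Qed.

Lemma ltr_pmulg u x : (x < u * x) = (1 < u).
Proof. by rewrite -[X in X < _]mul1g ltr_mulg2r. Qed.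

Lemma expg_gt1 u n : 1 < u -> (0 < n)%N -> 1 < u ^+ n.
Proof.
move=> u1; elim: n => [//|[|n] IH] _; first by rewrite expg1.
by rewrite expgS; apply: (lt_trans (IH isT)); rewrite ltr_pmulg.
Qed.

Lemma expg_ge1 u n : 1 < u -> 1 <= u ^+ n.
Proof. by case: n => [|n] u1; rewrite ?expg0 // ltW // expg_gt1. Qed.

Lemma expg_inj u m n : 1 < u -> u ^+ m = u ^+ n -> m = n.
Proof.
move=> u1; wlog le_mn : m n / (m <= n)%N => [W|].
  by case: (leqP m n) => [/W//|/ltnW/W + /esym e] => /(_ e).
move=> e; apply/eqP; rewrite eqn_leq le_mn leqNgt; apply/negP => lt_mn.
have := expg_gt1 u1 (_ : 0 < n - m)%N; rewrite subn_gt0 => /(_ lt_mn).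
by rewrite expgnFr // -e mulgV ltxx.
Qed.

Lemma fset_argmin (f : G -> G) X : X != fset0 ->
  exists2 x, x \in X & forall y, y \in X -> f x <= f y.
Proof.
move=> X0; have : f @` X != fset0.
  by case/fset0Pn: X0 => x xX; apply/fset0Pn; exists (f x); apply: in_imfset.
move=> /fset_minP-/(_ (fset_min (f @` X)))[/(_ erefl)[/imfsetP[x xX ->] min_x] _].
by exists x => // y yX; apply/min_x/in_imfset.
Qed.

(** A general [f] is needed because left translation may break the order: [x * y] need not be
    largest at the largest [y]. *)
Lemma fset_argmax (f : G -> G) X : X != fset0 ->
  exists2 x, x \in X & forall y, y \in X -> f y <= f x.
Proof.
move=> X0; have : f @` X != fset0.
  by case/fset0Pn: X0 => x xX; apply/fset0Pn; exists (f x); apply: in_imfset.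
move=> /fset_maxP-/(_ (fset_max (f @` X)))[/(_ erefl)[/imfsetP[x xX ->] max_x] _].
by exists x => // y yX; apply/max_x/in_imfset.
Qed.

(** * Product sets and their least possible size *)

(** [fset_sqr X] and [fset_mul X X] unfold to the same set. *)
Definition fset_mul X Y : {fset G} := [fset x * y | x in X, y in Y].

Lemma mem_fset_mul X Y x y : x \in X -> y \in Y -> x * y \in fset_mul X Y.
Proof. by move=> xX yY; apply/imfset2P; exists x => //; exists y. Qed.

Lemma fset_mulP X Y g :
  reflect (exists x y, [/\ x \in X, y \in Y & g = x * y]) (g \in fset_mul X Y).
Proof.
apply: (iffP idP) => [/imfset2P[x xX [y yY ->]]|[x [y [xX yY ->]]]].
  by exists x, y.
exact: mem_fset_mul.
Qed.

Lemma fset_mulS X X' Y Y' : X `<=` X' -> Y `<=` Y' ->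
  fset_mul X Y `<=` fset_mul X' Y'.
Proof.
move=> /fsubsetP sX /fsubsetP sY; apply/fsubsetP => _ /fset_mulP[x [y [xX yY ->]]].
by apply: mem_fset_mul; [apply: sX|apply: sY].
Qed.

Lemma card_fset_mul1l x Y : #|` fset_mul [fset x] Y| = #|` Y|.
Proof.
transitivity #|` [fset x * y | y in Y]|; last by rewrite card_imfset //; apply: mulgI.
congr #|` _|; apply/fsetP => g; apply/fset_mulP/imfsetP.
  by move=> [_ [y [/fset1P-> yY ->]]]; exists y.
by move=> [y yY ->]; exists x, y; rewrite fset11.
Qed.

Lemma card_fset_mul1r X y : #|` fset_mul X [fset y]| = #|` X|.
Proof.
transitivity #|` [fset x * y | x in X]|; last by rewrite card_imfset //; apply: mulIg.
congr #|` _|; apply/fsetP => g; apply/fset_mulP/imfsetP.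
  by move=> [x [_ [xX /fset1P-> ->]]]; exists x.
by move=> [x xX ->]; exists x, y; rewrite fset11.
Qed.

(* With y maximizing x * y, the product x * y exceeds all of (X `\ x) * Y. *)
Lemma card_fset_mul_max X Y x : x \in X -> (forall x', x' \in X -> x' <= x) ->
  Y != fset0 -> (#|` fset_mul (X `\ x) Y| < #|` fset_mul X Y|)%N.
Proof.
move=> xX max_x /(fset_argmax (fun y => x * y))[y yY max_y].
apply: fproper_ltn_card; rewrite fproperE fset_mulS ?fsubsetDl ?fsubset_refl //=.
apply/fsubsetPn; exists (x * y); first exact: mem_fset_mul.
apply/negP => /fset_mulP[x' [y' [/fsetD1P[x'x /max_x le_x'] y'Y e]]].
have := max_y _ y'Y; rewrite e leNgt ltr_mulg2r.
by rewrite lt_neqAle x'x le_x'.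
Qed.

(** Each removal of the maximum of [X] loses at least one product; the last remaining element
    contributes a translate of [Y]. *)
Lemma card_fset_mul X Y : X != fset0 -> Y != fset0 ->
  (#|` X| + #|` Y| <= #|` fset_mul X Y|.+1)%N.
Proof.
move=> + Y0; have [n] := ubnP #|` X|; elim: n X => // n IH X Xn X0.
have [x xX max_x] := fset_argmax id X0.
have := card_fset_mul_max xX max_x Y0.
have [X'0|X'0] := eqVneq (X `\ x) fset0.
  have -> : X = [fset x] by rewrite -(fsetD1K xX) X'0 fsetU0.
  by rewrite cardfs1 card_fset_mul1l.
move: Xn; rewrite (cardfsD1 x X) xX => Xn.
have := IH (X `\ x) Xn X'0; lia.
Qed.

(** * Structure of pairs whose product set has minimal size *)

(** Removing the maximum of [X] keeps the bound on the product set, so one can descend to the two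
    least elements of [X]. *)
Lemma fset_mul_small_pair X Y : (1 < #|` X|)%N -> Y != fset0 ->
    (#|` fset_mul X Y| < #|` X| + #|` Y|)%N ->
  exists x x', [/\ x \in X, x' \in X, x < x' &
    (#|` fset_mul [fset x; x'] Y| <= #|` Y|.+1)%N].
Proof.
move=> + Y0; have [n] := ubnP #|` X|; elim: n X => // n IH X Xn X1 XY.
have X0 : X != fset0 by rewrite -cardfs_gt0; lia.
have [x xX max_x] := fset_argmax id X0.
have lt_max := card_fset_mul_max xX max_x Y0.
have cX := cardfsD1 x X; rewrite xX in cX.
have [X2|X2] := leqP #|` X `\ x| 1.
  have /cardfs1P[y Xy] : #|` X `\ x| == 1%N by apply/eqP; lia.
  have /fsetD1P[yx yX] : y \in X `\ x by rewrite Xy fset11.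
  exists y, x; split=> //; first by rewrite lt_neqAle yx max_x.
  have -> : [fset y; x] = X by rewrite fsetUC -Xy fsetD1K.
  lia.
have [|||y [y' [yX y'X ? ?]]] := IH (X `\ x); [lia..|].
by exists y, y'; split=> //; [case/fsetD1P: yX|case/fsetD1P: y'X].
Qed.

(** By the bound for the pair, at most one element of [x * Y] lies outside [x' * Y]. The product of
    [x] with the least element of [Y] is such an element, so any other [y] satisfies
    [x * y = x' * y'] for some [y'] in [Y]. *)
Lemma fset_mul_small_chain X Y : {in X &, commutative *%g} ->
    (1 < #|` X|)%N -> Y != fset0 ->
    (#|` fset_mul X Y| < #|` X| + #|` Y|)%N ->
  exists u, [/\ 1 < u, exists x x', [/\ x \in X, x' \in X & u = x^-1 * x'] &
    forall y, y \in Y -> (forall y', y' \in Y -> y <= y') \/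
      (exists2 y', y' \in Y & y = u * y')].
Proof.
move=> cX X1 Y0 /(fset_mul_small_pair X1 Y0)[x [x' [xX x'X lt_xx' cY]]].
exists (x^-1 * x').
have u1 : 1 < x^-1 * x'.
  (* Right invariance alone gives [1 < x' * x^-1]; commutativity in [X] transfers this to
     [x^-1 * x']. *)
  rewrite -(ltr_pmulg _ x) -mulgA (cX _ _ x'X xX) mulKg //.
split=> //; first by exists x, x'.
have [y0 y0Y min_y] := fset_argmin id Y0.
move=> y yY; have [->|ny] := eqVneq y y0; first by left.
right; apply: contrapT => nex.
have : [fset x * y0; x * y] `|` fset_mul [fset x'] Y `<=` fset_mul [fset x; x'] Y.
  rewrite !fsubUset !fsub1set !mem_fset_mul ?in_fset2 ?eqxx ?orbT //=.
  by apply: fset_mulS => //; rewrite fsub1set in_fset2 eqxx orbT.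
move=> /fsubset_leq_card; rewrite cardfsU card_fset_mul1l.
suff -> : [fset x * y0; x * y] `&` fset_mul [fset x'] Y = fset0.
  by rewrite cardfs2 (inj_eq (mulgI x)) eq_sym ny cardfs0; lia.
apply/fsetP => g; rewrite in_fset0; apply/negP => /fsetIP[gX /fset_mulP[_ [y' [/fset1P-> y'Y eg]]]].
have e w : x' * y' = x * w -> w = (x^-1 * x') * y'.
  by move=> E; rewrite -mulgA E mulKg.
move: gX; rewrite {g}eg => /fset2P[] /e E; last by apply: nex; exists y'.
by have := min_y _ y'Y; rewrite E leNgt ltr_pmulg u1.
Qed.

(** As [1 < u], a step from [u * y'] to [y'] goes down, so the number of elements of [Y] below the
    current one serves as induction measure. *)
Lemma chain_ind Y u (P : G -> Prop) : 1 < u ->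
    (forall y, y \in Y -> (forall y', y' \in Y -> y <= y') \/
      (exists2 y', y' \in Y & y = u * y')) ->
    (forall y, y \in Y -> (forall y', y' \in Y -> y <= y') -> P y) ->
    (forall y, y \in Y -> P y -> P (u * y)) ->
  forall y, y \in Y -> P y.
Proof.
move=> u1 chain P0 Pu y; have [n] := ubnP #|` [fset x in Y | x < y]|.
elim: n y => // n IH y ny yY; have [/P0|[y' y'Y e]] := chain y yY; first exact.
rewrite e; apply: Pu => //; apply: IH => //.
have lt_y : y' < y by rewrite e ltr_pmulg.
move: ny; rewrite ltnS; apply/leq_trans/fproper_ltn_card.
rewrite fproperE; apply/andP; split.
  apply/fsubsetP => x; rewrite !inE => /andP[-> /= /lt_trans]; exact.
by apply/fsubsetPn; exists y'; rewrite !inE ?y'Y ?lt_y ?ltxx.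
Qed.

(** * Centralizers, and commutation forced by minimal product sets *)

(** Boolean, so that it can filter a finite set. *)
Definition cent S g := all (fun s => g * s == s * g) S.

Lemma centP S g : reflect (forall s, s \in S -> g * s = s * g) (cent S g).
Proof. by apply: (iffP allP) => cSg s /cSg /eqP. Qed.

Lemma centM S x y : cent S x -> cent S y -> cent S (x * y).
Proof.
move=> /centP cx /centP cy; apply/centP => s sS.
by rewrite -mulgA cy // !mulgA cx.
Qed.

Lemma centV S x : cent S x -> cent S x^-1.
Proof.
move=> /centP cx; apply/centP => s sS.
by apply: (mulgI x); rewrite mulVKg mulgA cx // mulgK.
Qed.

Lemma cent_mull S x y : cent S x -> cent S (x * y) = cent S y.
Proof.
move=> cx; apply/idP/idP => [/(centM (centV cx))|/(centM cx)//].
by rewrite mulKg.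
Qed.

Lemma cent_mulr S x y : cent S y -> cent S (x * y) = cent S x.
Proof.
move=> cy; apply/idP/idP => [/centM/(_ (centV cy))|/centM/(_ cy)//].
by rewrite mulgK.
Qed.

(** The chain reaches [y] from [y0] by left factors [u], a quotient of elements of the commutative
    set [X]. *)
Lemma fset_mul_small_cent X Y y0 y : {in X &, commutative *%g} ->
    (1 < #|` X|)%N -> (#|` fset_mul X Y| < #|` X| + #|` Y|)%N ->
    y0 \in Y -> (forall y', y' \in Y -> y0 <= y') -> y \in Y ->
  cent X (y * y0^-1).
Proof.
move=> cX X1 XY y0Y min_y yY.
have Y0 : Y != fset0 by apply/fset0Pn; exists y.
have [u [u1 [x [x' [xX x'X eu]]] chain]] := fset_mul_small_chain cX X1 Y0 XY.
have cXX z : z \in X -> cent X z by move=> zX; apply/centP => s sX; apply: cX.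
have cu : cent X u by rewrite eu centM ?centV ?cXX.
move: y yY; apply: (chain_ind u1 chain) => [y yY min_y'|y yY cy].
  have -> : y = y0 by apply/le_anti; rewrite min_y' // min_y.
  by rewrite mulgV; apply/centP => s _; rewrite mul1g mulg1.
by rewrite -mulgA cent_mull.
Qed.

(* Both X and Y lie in single cosets of the common centralizer, so the least
   elements of X * Y and Y * X are the products of the least elements. *)
Lemma fset_mul_small_commute X Y :
    {in X &, commutative *%g} -> {in Y &, commutative *%g} ->
    (1 < #|` X|)%N -> (1 < #|` Y|)%N ->
    (#|` fset_mul X Y `|` fset_mul Y X| < #|` X| + #|` Y|)%N ->
  forall x y, x \in X -> y \in Y -> x * y = y * x.
Proof.
move=> cX cY X1 Y1 W.
have X0 : X != fset0 by rewrite -cardfs_gt0; lia.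
have Y0 : Y != fset0 by rewrite -cardfs_gt0; lia.
have lXY := card_fset_mul X0 Y0; have lYX := card_fset_mul Y0 X0.
(* Each of the two product sets already has at least |X| + |Y| - 1 elements, so each is the whole
   union. *)
have eXY : fset_mul X Y = fset_mul X Y `|` fset_mul Y X.
  by apply/eqP; rewrite eqEfcard fsubsetUl; lia.
have eYX : fset_mul Y X = fset_mul X Y `|` fset_mul Y X.
  by apply/eqP; rewrite eqEfcard fsubsetUr; lia.
have [x0 x0X min_x] := fset_argmin id X0.
have [y0 y0Y min_y] := fset_argmin id Y0.
have cgx x : x \in X -> cent Y (x * x0^-1).
  by apply: fset_mul_small_cent; rewrite // eYX addnC.
have cgy y : y \in Y -> cent X (y * y0^-1).
  by apply: fset_mul_small_cent; rewrite // eXY.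
have ge1 g h : h <= g -> 1 <= g * h^-1 by rewrite -(ler_mulg2r h 1) mulgVK mul1g.
(* Left translation by [x0] need not be monotone; the factor [y * y0^-1] commutes with [x0], so it
   can be moved to the front and compared with 1. *)
have min_xy x y : x \in X -> y \in Y -> x0 * y0 <= x * y.
  move=> xX yY; apply: (@le_trans _ _ (x0 * y)).
    rewrite -[y](mulgVK y0) mulgA -(centP _ _ (cgy _ yY)) // -mulgA.
    by rewrite -[X in X <= _]mul1g ler_mulg2r ge1 ?min_y.
  by rewrite ler_mulg2r min_x.
have min_yx x y : x \in X -> y \in Y -> y0 * x0 <= y * x.
  move=> xX yY; apply: (@le_trans _ _ (y0 * x)).
    rewrite -[x](mulgVK x0) mulgA -(centP _ _ (cgx _ xX)) // -mulgA.
    by rewrite -[X in X <= _]mul1g ler_mulg2r ge1 ?min_x.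
  by rewrite ler_mulg2r min_y.
have e0 : x0 * y0 = y0 * x0.
  apply/le_anti; apply/andP; split.
    have : y0 * x0 \in fset_mul X Y by rewrite eXY -eYX mem_fset_mul.
    by case/fset_mulP => x [y [xX yY ->]]; apply: min_xy.
  have : x0 * y0 \in fset_mul Y X by rewrite eYX -eXY mem_fset_mul.
  by case/fset_mulP => y [x [yY xX ->]]; apply: min_yx.
move=> x y xX yY; have gx := centP _ _ (cgx _ xX); have gy := centP _ _ (cgy _ yY).
have x0y : x0 * y = y * x0.
  by rewrite -[y](mulgVK y0) mulgA -gy // -!mulgA e0.
by rewrite -[x](mulgVK x0) -mulgA x0y mulgA gx // !mulgA.
Qed.

(** Here the chain lies in [X] itself and [u] commutes with [X], so the chain is a progression from
    the minimum. The last clause says that it has no gaps. *)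
Lemma fset_sqr_small_progression X : {in X &, commutative *%g} ->
    (1 < #|` X|)%N -> (#|` fset_mul X X| < #|` X| + #|` X|)%N ->
  exists x u, [/\ 1 < u, cent X u, x \in X,
    forall y, y \in X -> exists i, y = x * u ^+ i &
    forall i, x * u ^+ i.+1 \in X -> x * u ^+ i \in X].
Proof.
move=> cX X1 XX; have X0 : X != fset0 by rewrite -cardfs_gt0; lia.
have [u [u1 [x1 [x2 [x1X x2X eu]]] chain]] := fset_mul_small_chain cX X1 X0 XX.
have cXX z : z \in X -> cent X z by move=> zX; apply/centP => s sX; apply: cX.
have cu : cent X u by rewrite eu centM ?centV ?cXX.
have [x xX min_x] := fset_argmin id X0; exists x, u; split=> //.
  apply: (chain_ind u1 chain) => [y yX min_y|y yX [i ->]].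
    by exists 0%N; apply/le_anti; rewrite expg0 mulg1 min_x ?min_y.
  by exists i.+1; rewrite mulgA (centP _ _ cu) // -mulgA -expgS.
have cxu i : x * u ^+ i = u ^+ i * x by apply/commuteX/esym/(centP _ _ cu).
move=> i /chain[/(_ _ xX)|[y' y'X]].
  by rewrite cxu leNgt ltr_pmulg expg_gt1.
by rewrite expgS mulgA -(centP _ _ cu) // -mulgA => /mulgI ->.
Qed.

(** * Splitting into noncentral and central parts, and disjoint pieces of the square *)

(** This is the part A0 of [A], and [central A B] is A1; exchanging the arguments gives B0 and
    B1. *)
Definition noncentral A B : {fset G} := [fset a in A | ~~ cent B a].
Definition central A B : {fset G} := [fset a in A | cent B a].

Lemma in_noncentral A B a : a \in noncentral A B = (a \in A) && ~~ cent B a.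
Proof. by rewrite !inE. Qed.

Lemma in_central A B a : a \in central A B = (a \in A) && cent B a.
Proof. by rewrite !inE. Qed.

Lemma card_noncentral A B : #|` A| = (#|` noncentral A B| + #|` central A B|)%N.
Proof.
rewrite -cardfsUI (_ : _ `&` _ = fset0) ?cardfs0 ?addn0.
  congr #|` _|; apply/fsetP => x; rewrite in_fsetU in_noncentral in_central.
  by case: (x \in A); case: (cent B x).
apply/fsetP => x; rewrite in_fsetI in_noncentral in_central in_fset0.
by case: (x \in A); case: (cent B x).
Qed.

Lemma cardfsU_disjoint X Y : (forall x, x \in X -> x \in Y -> False) ->
  #|` X `|` Y| = (#|` X| + #|` Y|)%N.
Proof.
move=> dXY; rewrite -cardfsUI (_ : X `&` Y = fset0) ?cardfs0 ?addn0 //.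
by apply/fsetP => x; rewrite in_fsetI in_fset0; apply/negP => /andP[/dXY].
Qed.

Lemma cent_self A : {in A &, commutative *%g} -> forall a, a \in A -> cent A a.
Proof. by move=> cA a aA; apply/centP => s sA; apply: cA. Qed.

(* Elements of the four pieces are told apart by whether they centralize A and
   whether they centralize B. *)
Lemma card_fset_sqrU A B :
    {in A &, commutative *%g} -> {in B &, commutative *%g} ->
  (#|` fset_mul A A `|` fset_mul B B| +
   #|` fset_mul (noncentral A B) (noncentral B A) `|`
       fset_mul (noncentral B A) (noncentral A B)| +
   #|` fset_mul (noncentral A B) (central B A) `\` fset_mul A A| +
   #|` fset_mul (noncentral B A) (central A B) `\` fset_mul B B|
   <= #|` fset_mul (A `|` B) (A `|` B)|)%N.
Proof.
move=> cA cB; have cAA := cent_self cA; have cBB := cent_self cB.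
set W := fset_mul (noncentral A B) _ `|` _.
set P := fset_mul (noncentral A B) (central B A) `\` _.
set Q := fset_mul (noncentral B A) (central A B) `\` _.
have hW x : x \in W -> ~~ cent A x /\ ~~ cent B x.
  case/fsetUP => /fset_mulP[a [b [+ + ->]]];
    rewrite !in_noncentral => /andP[aA na] /andP[bB nb].
    by rewrite (cent_mull _ (cAA _ aA)) (cent_mulr _ (cBB _ bB)).
  by rewrite (cent_mulr _ (cAA _ bB)) (cent_mull _ (cBB _ aA)).
have hP x : x \in P -> [/\ cent A x, ~~ cent B x & x \notin fset_mul A A].
  case/fsetDP => /fset_mulP[a [b [+ + ->]]] nx.
  rewrite in_noncentral in_central => /andP[aA na] /andP[bA nb].
  by split; rewrite // ?(cent_mull _ (cAA _ aA)) ?(cent_mulr _ (cBB _ bA)).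
have hQ x : x \in Q -> [/\ cent B x, ~~ cent A x & x \notin fset_mul B B].
  case/fsetDP => /fset_mulP[a [b [+ + ->]]] nx.
  rewrite in_noncentral in_central => /andP[aA na] /andP[bA nb].
  by split; rewrite // ?(cent_mull _ (cBB _ aA)) ?(cent_mulr _ (cAA _ bA)).
have hS X x : {in X &, commutative *%g} -> x \in fset_mul X X -> cent X x.
  by move=> cX /fset_mulP[y [z [yX zX ->]]]; rewrite centM // cent_self.
rewrite -!cardfsU_disjoint.
- apply: fsubset_leq_card; rewrite !fsubUset.
  have sA X : noncentral A X `<=` A `|` B /\ central A X `<=` A `|` B.
    by split; apply/fsubsetP => x; rewrite ?in_noncentral ?in_central in_fsetU => /andP[->].
  have sB X : noncentral B X `<=` A `|` B /\ central B X `<=` A `|` B.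
    by split; apply/fsubsetP => x; rewrite ?in_noncentral ?in_central in_fsetU orbC => /andP[->].
  have [sA1 sA2] := sA B; have [sB1 sB2] := sB A.
  by rewrite !fset_mulS ?fsubsetUl ?fsubsetUr //= !(fsubset_trans (fsubsetDl _ _)) ?fset_mulS.
- move=> x + /hQ[cx ncx nx].
  move=> /fsetUP[/fsetUP[/fsetUP[/(hS _ _ cA)|]|/hW[_]]|/hP[]].
  + by rewrite (negPf ncx).
  + by rewrite (negPf nx).
  + by rewrite cx.
  + by rewrite (negPf ncx).
- move=> x + /hP[cx ncx nx] => /fsetUP[/fsetUP[|/(hS _ _ cB)]|/hW[]].
  + by rewrite (negPf nx).
  + by rewrite (negPf ncx).
  + by rewrite cx.
- by move=> x /fsetUP[/(hS _ _ cA)|/(hS _ _ cB)] cx /hW[]; rewrite cx.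
Qed.

(** If [a * z = x * y] with both factors in [A], one of them, say [x], fails to centralize [B], as
    [a * z] does. Then [y < z] gives [a * z = y * x < z * x = x * z], so [a < x], against
    maximality. *)
Lemma mul_max_noncentral A B a z : {in A &, commutative *%g} -> ~~ cent B a ->
    (forall a', a' \in noncentral A B -> a' <= a) ->
    (forall x, x \in A -> x < z) -> cent A z -> cent B z ->
  a * z \notin fset_mul A A.
Proof.
move=> cA na max_a ltz cAz cBz; apply/negP => /fset_mulP[x [y [xA yA e]]].
wlog nx : x y xA yA e / ~~ cent B x.
  move=> W; case: (boolP (cent B x)) => [cx|]; last exact: W xA yA e.
  apply: (W y x) => //; first by rewrite e cA.
  by rewrite -(cent_mull _ cx) -e cent_mulr.
have : a * z < z * x by rewrite e (cA _ _ xA yA) ltr_mulg2r ltz.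
by rewrite (centP _ _ cAz) // ltr_mulg2r ltNge max_a // in_noncentral xA.
Qed.

(** The order dual, applied later with the two sets exchanged. *)
Lemma mul_min_noncentral A B a z : {in A &, commutative *%g} -> ~~ cent B a ->
    (forall a', a' \in noncentral A B -> a <= a') ->
    (forall x, x \in A -> z < x) -> cent A z -> cent B z ->
  a * z \notin fset_mul A A.
Proof.
move=> cA na min_a ltz cAz cBz; apply/negP => /fset_mulP[x [y [xA yA e]]].
wlog nx : x y xA yA e / ~~ cent B x.
  move=> W; case: (boolP (cent B x)) => [cx|]; last exact: W xA yA e.
  apply: (W y x) => //; first by rewrite e cA.
  by rewrite -(cent_mull _ cx) -e cent_mulr.
have : z * x < a * z by rewrite e (cA _ _ xA yA) ltr_mulg2r ltz.
by rewrite (centP _ _ cAz) // ltr_mulg2r ltNge min_a // in_noncentral xA.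
Qed.

(** * The exceptional cases: one noncentral element, or intersecting squares *)

(** With C = [central A B], the sets C C and a C are disjoint, since only the first centralizes [B].
    They have at least 2|C| - 1 and exactly |C| elements, and |C| = |A| - 1. *)
Lemma card_fset_sqr_noncentral1 A B a : {in A &, commutative *%g} ->
  (2 <= #|` A|)%N -> noncentral A B = [fset a] -> (3 * #|` A| <= #|` fset_mul A A| + 4)%N.
Proof.
move=> cA A2 eA; have cardA := card_noncentral A B; rewrite eA cardfs1 in cardA.
have c0 : central A B != fset0 by rewrite -cardfs_gt0; lia.
have := card_fset_mul c0 c0.
suff : (#|` fset_mul (central A B) (central A B)| + #|` central A B| <= #|` fset_mul A A|)%N.
  lia.
have sA : central A B `<=` A by apply/fsubsetP => x; rewrite in_central => /andP[].
have : a \in noncentral A B by rewrite eA fset11.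
rewrite in_noncentral => /andP[aA na].
rewrite -(card_fset_mul1l a (central A B)) -cardfsU_disjoint => [|x /fset_mulP[y [z [+ + ->]]]].
  by apply: fsubset_leq_card; rewrite fsubUset; apply/andP; split; apply: fset_mulS; rewrite ?fsub1set.
rewrite !in_central => /andP[_ cy] /andP[_ cz] /fset_mulP[_ [w [/fset1P-> + e]]].
by rewrite in_central => /andP[_ cw]; move: na; rewrite -(cent_mulr _ cw) -e centM.
Qed.

(* Conjugation by b acts on the exponents N with x * u ^+ N = z by a fixed
   rational factor; permuting a finite set of them, it must fix them. *)
Lemma progression_conj_fix A X b z x0 u : {in A &, commutative *%g} ->
    1 < u -> cent A u -> x0 \in A ->
    (forall y, y \in A -> exists i, y = x0 * u ^+ i) ->
    (forall y, y \in A -> y < z) ->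
    (exists2 a, a \in A & a * z \in fset_mul A A) ->
    X `<=` A -> X != fset0 -> b * z = z * b ->
    fset_mul X [fset b] = fset_mul [fset b] X ->
  exists2 x, x \in X & b * x = x * b.
Proof.
move=> cA u1 cu x0A prog ltz [a aA azA] /fsubsetP sXA X0 cbz eX.
have cX x i : x \in A -> x * u ^+ i = u ^+ i * x.
  by move=> xA; apply/commuteX/esym/(centP _ _ cu).
have ge1 x i : x <= u ^+ i * x by rewrite -[X in X <= _]mul1g ler_mulg2r expg_ge1.
have [s zE] : exists s, z = u ^+ s * x0.
  case/fset_mulP: azA => x [y [xA yA]].
  have [i ->] := prog _ aA; have [j ->] := prog _ xA; have [k ->] := prog _ yA.
  rewrite -!mulgA => /mulgI; rewrite cX // mulgA -expgnDr => e.
  case: (leqP i (j + k)) => [le_i|/ltnW le_jk].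
    exists (j + k - i)%N; apply: (mulgI (u ^+ i)).
    by rewrite mulgA -expgnDr subnKC.
  have : z <= x0.
    suff -> : x0 = u ^+ (i - (j + k)) * z by [].
    by apply: (mulgI (u ^+ (j + k))); rewrite mulgA -expgnDr subnKC.
  by rewrite leNgt ltz.
have expA x : x \in A -> exists2 N, (0 < N)%N & x * u ^+ N = z.
  move=> xA; have [i xE] := prog _ xA; have := ltz _ xA.
  case: (leqP s i) => [le_si|lt_is _].
    rewrite xE cX // -(subnK le_si) expgnDr -mulgA -zE ltNge; by rewrite ge1.
  exists (s - i)%N; first by rewrite subn_gt0.
  by rewrite cX // xE cX // mulgA -expgnDr subnK // ltnW.
have exp_le x x' N N' : x' \in A -> x <= x' -> x * u ^+ N = z ->
    x' * u ^+ N' = z -> (N' <= N)%N.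
  move=> x'A le_x xN x'N; rewrite leqNgt; apply/negP => lt_N.
  have : x = u ^+ (N' - N) * x'.
    apply: (mulIg (u ^+ N)); rewrite xN -x'N -cX // -mulgA -expgnDr subnK //.
    exact: ltnW.
  by move=> e; move: le_x; rewrite e leNgt ltr_pmulg expg_gt1 // subn_gt0.
(* The least [x] has the largest exponent [N], which bounds the exponents of its image and of its
   preimage under conjugation. *)
have [x xX min_x] := fset_argmin id X0.
have [x' x'X bx] : exists2 x', x' \in X & b * x = x' * b.
  have : b * x \in fset_mul X [fset b] by rewrite eX mem_fset_mul ?fset11.
  by case/fset_mulP => x' [_ [x'X /fset1P-> e]]; exists x'.
have [y yX xb] : exists2 y, y \in X & x * b = b * y.
  have : x * b \in fset_mul [fset b] X by rewrite -eX mem_fset_mul ?fset11.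
  by case/fset_mulP => _ [y [/fset1P-> yX e]]; exists y.
have [N N0 xN] := expA _ (sXA _ xX).
have [N' _ x'N] := expA _ (sXA _ x'X).
have [M _ yM] := expA _ (sXA _ yX).
have leN' := exp_le _ _ _ _ (sXA _ x'X) (min_x _ x'X) xN x'N.
have leM := exp_le _ _ _ _ (sXA _ yX) (min_x _ yX) xN yM.
have conjE g h : b * g = h * b -> g ^ b^-1 = h.
  by move=> e; rewrite conjgE invgK mulgA e mulgK.
have powE g n : g * u ^+ n = z -> u ^+ n = g^-1 * z by move=> <-; rewrite mulKg.
have eN : (u ^+ N) ^ b^-1 = u ^+ N'.
  by rewrite (powE _ _ xN) (powE _ _ x'N) conjMg conjVg (conjE _ _ bx) (conjE _ _ cbz).
have eM : (u ^+ M) ^ b^-1 = u ^+ N.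
  rewrite (powE _ _ yM) (powE _ _ xN) conjMg conjVg.
  by rewrite (conjE _ _ (esym xb)) (conjE _ _ cbz).
(* Conjugation sends exponent [M] to [N] and [N] to [N'], so [N' * M = N * N] with both factors at
   most [N]. *)
have : u ^+ (N' * M) = u ^+ (N * N).
  by rewrite expgnA -eN -conjXg expgnAC conjXg eM -expgnA.
move=> /(expg_inj u1) eNM; have eNN : N' = N by nia.
exists x => //; rewrite bx; congr (_ * _); apply: (mulIg (u ^+ N)).
by rewrite xN -eNN.
Qed.

(* Conjugation by a squares to the identity on u, so it sends u to u or its
   inverse; the first case makes a and b commute, the second reverses a * b < b * a. *)
Lemma square_eq_absurd a b u i j : 1 < u -> b * u = u * b -> a * a = b * b ->
    a * b < b * a -> a * (b * u) = b * u ^+ i * a ->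
    a * (b * u ^+ 2) = b * u ^+ j * a -> False.
Proof.
move=> u1 cbu eab lt_ab e1 e2.
have conjE g h : a * g = h * a -> g ^ a^-1 = h.
  by move=> e; rewrite conjgE invgK mulgA e mulgK.
have conj2 g : b * g = g * b -> (g ^ a^-1) ^ a^-1 = g.
  move=> cbg; rewrite -conjgM -invgM eab; apply/conjg_fixP/commgP/commuteV.
  by apply/commuteM; rewrite /commute cbg.
have {conjE} [c1 c2] := (conjE _ _ e1, conjE _ _ e2).
have cbX n : b * u ^+ n = u ^+ n * b by apply/commuteX.
have cb : b ^ a^-1 * u ^ a^-1 = b * u ^+ i by rewrite -conjMg.
have cu : b * u ^+ i * u ^ a^-1 = b * u ^+ j.
  by rewrite -c2 conjMg conjXg expg2 [in RHS]mulgA cb.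
have nb : b ^ a^-1 <> b.
  rewrite conjgE invgK mulgA => e; move: lt_ab.
  by rewrite -[a * b](mulgVK a) e ltxx.
case: (leqP i j) => [le_ij|/ltnW le_ji].
  have {}cu : u ^ a^-1 = u ^+ (j - i).
    by apply: (mulgI (b * u ^+ i)); rewrite cu -mulgA -expgnDr subnKC.
  have : u ^+ ((j - i) * (j - i)) = u ^+ 1.
    by rewrite expgnA -{1}cu -conjXg -cu conj2.
  move=> /(expg_inj u1) k1; have {}k1 : (j - i = 1)%N by nia.
  rewrite k1 expg1 in cu; rewrite cu in cb.
  (* Conjugating [cb] once more, with [u] fixed, gives a second relation. Comparing exponents yields
     [i + i = 2], so [b] would be fixed too. *)
  have cb2 : b * u = b ^ a^-1 * u ^+ i.
    transitivity ((b ^ a^-1) ^ a^-1 * u ^ a^-1); first by rewrite conj2 // cu.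
    by rewrite -conjMg cb conjMg conjXg cu.
  have : b * u ^+ (i + i) = b * u ^+ 2.
    by rewrite expgnDr mulgA -cb -mulgA -expgS expgSr mulgA -cb2 -mulgA.
  move=> /mulgI /(expg_inj u1) i1; apply/nb/(mulIg u); rewrite cb.
  by rewrite (_ : i = 1%N) ?expg1 //; lia.
have {}cu : u ^+ (i - j) * u ^ a^-1 = 1.
  apply: (mulgI (b * u ^+ j)); rewrite mulg1 -[in RHS]cu -[in RHS](subnKC le_ji).
  by rewrite expgnDr -!mulgA.
have {}cu : u ^ a^-1 = (u ^+ (i - j))^-1 by rewrite (mulg1_eq cu).
have : u ^+ 1 = u ^+ ((i - j) * (i - j)).
  rewrite expg1 -[LHS]conj2 // cu conjVg conjXg cu expVgn invgK -expgnA //.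
move=> /(expg_inj u1) k1; have {}k1 : (i - j = 1)%N by nia.
rewrite k1 expg1 in cu; rewrite cu in cb.
have {}cb : b ^ a^-1 = u ^+ i.+1 * b.
  by rewrite -cbX expgSr mulgA -cb mulgVK.
have : a * b = u ^+ i.+1 * (b * a).
  by rewrite mulgA -cb conjgE invgK mulgA mulgVK.
by move=> e; move: lt_ab; rewrite e ltNge ltW // ltr_pmulg expg_gt1.
Qed.

(** Elements of [B] outside [noncentral B A] commute with [a] anyway. *)
Lemma noncentral_absurd A B a : a \in noncentral A B ->
  (forall b, b \in noncentral B A -> a * b = b * a) -> False.
Proof.
rewrite in_noncentral => /andP[aA /negP na] cab; apply/na/centP => b bB.
have [cb|nb] := boolP (cent A b); first by rewrite (centP _ _ cb).
by apply: cab; rewrite in_noncentral bB.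
Qed.

Lemma sub_noncentral A B : noncentral A B `<=` A.
Proof. by apply/fsubsetP => x; rewrite in_noncentral => /andP[]. Qed.

Lemma fset_mul_noncentral_max A B a :
    {in A &, commutative *%g} -> {in B &, commutative *%g} ->
    (forall x y, x \in A -> y \in B -> x < y) -> a \in noncentral A B ->
    (forall x, x \in noncentral A B -> x <= a) ->
  fset_mul [fset a] (central B A) `<=`
    fset_mul (noncentral A B) (central B A) `\` fset_mul A A.
Proof.
move=> cA cB ltAB aA max_a; apply/fsubsetP => _ /fset_mulP[_ [z [/fset1P-> zB ->]]].
apply/fsetDP; split; first exact: mem_fset_mul.
move: zB aA; rewrite in_central in_noncentral => /andP[zB cz] /andP[aA na].
apply: (mul_max_noncentral cA na max_a) => //; last exact: cent_self.
by move=> x xA; apply: ltAB.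
Qed.

Lemma fset_mul_noncentral_min A B b :
    {in A &, commutative *%g} -> {in B &, commutative *%g} ->
    (forall x y, x \in A -> y \in B -> x < y) -> b \in noncentral B A ->
    (forall y, y \in noncentral B A -> b <= y) ->
  fset_mul [fset b] (central A B) `<=`
    fset_mul (noncentral B A) (central A B) `\` fset_mul B B.
Proof.
move=> cA cB ltAB bB min_b; apply/fsubsetP => _ /fset_mulP[_ [z [/fset1P-> zA ->]]].
apply/fsetDP; split; first exact: mem_fset_mul.
move: zA bB; rewrite in_central in_noncentral => /andP[zA cz] /andP[bB nb].
apply: (mul_min_noncentral cB nb min_b) => //; last exact: cent_self.
by move=> y yB; apply: ltAB.
Qed.

(** The bounds make [A] a progression, give A0 b = b A0, and force a product [a' * z] with [z] in
    [central B A] into the square of [A]. Conjugation by [b] then fixes an element of A0, which is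
    absurd. *)
Lemma single_noncentral_absurd A B b :
    {in A &, commutative *%g} -> {in B &, commutative *%g} ->
    (forall x y, x \in A -> y \in B -> x < y) ->
    (1 < #|` noncentral A B|)%N -> noncentral B A = [fset b] ->
    central B A != fset0 ->
    (#|` fset_mul (noncentral A B) (noncentral B A) `|`
         fset_mul (noncentral B A) (noncentral A B)| <= #|` noncentral A B|)%N ->
    (#|` fset_mul A A| < #|` A| + #|` A|)%N ->
    (#|` fset_mul (noncentral A B) (central B A) `\` fset_mul A A|
      <= #|` central B A|)%N ->
  False.
Proof.
move=> cA cB ltAB p2 eB B1 W AA P.
have A0 : noncentral A B != fset0 by rewrite -cardfs_gt0; lia.
have A2 : (1 < #|` A|)%N by rewrite (card_noncentral A B); lia.
have [x0 [u [u1 cu x0A prog _]]] := fset_sqr_small_progression cA A2 AA.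
have [a aA max_a] := fset_argmax id A0.
have [z zB min_z] := fset_argmin id B1.
have [a' /fsetD1P[a'a a'A]] : exists a', a' \in noncentral A B `\ a.
  by apply/fset0Pn; rewrite -cardfs_gt0; move: p2; rewrite (cardfsD1 a) aA; lia.
have sP := fset_mul_noncentral_max cA cB ltAB aA max_a.
have zB' := zB; rewrite in_central in zB'; case/andP: zB' => zB' cz.
(* Otherwise [a' * z] and the translate of [central B A] by [a] give one element too many; it is
   outside the translate because [a' * z < a * z <= a * y]. *)
have a'z : a' * z \in fset_mul A A.
  apply: contraLR P => na'z; rewrite -ltnNge -(card_fset_mul1l a (central B A)).
  have na'z1 : a' * z \notin fset_mul [fset a] (central B A).
    apply/negP => /fset_mulP[_ [y [/fset1P-> yB e]]].
    have : a' * z < a * z by rewrite ltr_mulg2r lt_neqAle a'a max_a.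
    move: (yB) (min_z _ yB); rewrite e in_central => /andP[_ cy].
    move: aA; rewrite in_noncentral => /andP[aA _].
    by rewrite -(centP _ _ cy) // -(centP _ _ cz) // ltr_mulg2r leNgt => /negPf->.
  have <- : #|` a' * z |` fset_mul [fset a] (central B A)| =
      #|` fset_mul [fset a] (central B A)|.+1 by rewrite cardfsU1 na'z1.
  apply: fsubset_leq_card; rewrite fsubUset fsub1set sP andbT.
  by apply/fsetDP; split=> //; apply: mem_fset_mul.
have cA0 : #|` fset_mul (noncentral A B) [fset b]| = #|` noncentral A B|.
  exact: card_fset_mul1r.
have cA0' : #|` fset_mul [fset b] (noncentral A B)| = #|` noncentral A B|.
  exact: card_fset_mul1l.
rewrite eB in W.
have eX : fset_mul (noncentral A B) [fset b] = fset_mul [fset b] (noncentral A B).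
  transitivity (fset_mul (noncentral A B) [fset b] `|`
                fset_mul [fset b] (noncentral A B)).
    by apply/eqP; rewrite eqEfcard fsubsetUl cA0.
  by apply/esym/eqP; rewrite eqEfcard fsubsetUr cA0'.
have bB : b \in B by apply: (fsubsetP (sub_noncentral B A)); rewrite eB fset11.
have [||||||x xA bx] := progression_conj_fix (X := noncentral A B) (b := b) (z := z) cA u1 cu x0A prog.
- by move=> y yA; apply: ltAB.
- by exists a' => //; apply: (fsubsetP (sub_noncentral A B)).
- exact: sub_noncentral.
- exact: A0.
- exact: cB.
- exact: eX.
apply: (noncentral_absurd xA) => y; rewrite eB => /fset1P->.
by rewrite bx.
Qed.

(** For a = max(A) and b = min(B), a common element forces a^2 = b^2, hence ab < b^2 = a^2 < ba. So
    A0 b lies below B0 a, which gives the first bound. If these two sets fill [W] and [B] is a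
    progression from b, conjugation by [a] leads to a contradiction. *)
Lemma equal_squares_card A B e :
    {in A &, commutative *%g} -> {in B &, commutative *%g} ->
    (forall x y, x \in A -> y \in B -> x < y) ->
    (forall x y, x \in fset_mul A A -> y \in fset_mul B B -> x <= y) ->
    e \in fset_mul A A -> e \in fset_mul B B -> (2 < #|` B|)%N ->
  let W := fset_mul (noncentral A B) (noncentral B A) `|`
           fset_mul (noncentral B A) (noncentral A B) in
  (#|` noncentral A B| + #|` noncentral B A| <= #|` W|)%N /\
  ((#|` W| <= #|` noncentral A B| + #|` noncentral B A|)%N ->
   (#|` B| + #|` B| <= #|` fset_mul B B|)%N).
Proof.
move=> cA cB ltAB leAB eA eB B3 W.
have A0 : A != fset0 by case/fset_mulP: eA => x [_ [xA _ _]]; apply/fset0Pn; exists x.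
have B0 : B != fset0 by case/fset_mulP: eB => x [_ [xB _ _]]; apply/fset0Pn; exists x.
have [a aA max_a] := fset_argmax id A0.
have [b bB min_b] := fset_argmin id B0.
have eab : a * a = b * b.
  apply/le_anti; rewrite leAB ?mem_fset_mul //=; apply: (@le_trans _ _ e).
    case/fset_mulP: eB => x [y [xB yB ->]]; apply: (@le_trans _ _ (b * y)).
      by rewrite cB // ler_mulg2r min_b.
    by rewrite ler_mulg2r min_b.
  case/fset_mulP: eA => x [y [xA yA ->]]; apply: (@le_trans _ _ (a * y)).
    by rewrite ler_mulg2r max_a.
  by rewrite cA // ler_mulg2r max_a.
have lt_ab : a * b < b * a.
  by apply: (@lt_trans _ _ (b * b)); [|rewrite -eab]; rewrite ltr_mulg2r ltAB.
have aA0 : a \in noncentral A B.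
  rewrite in_noncentral aA; apply/negP => /centP/(_ b bB) e1.
  by rewrite e1 ltxx in lt_ab.
have bB0 : b \in noncentral B A.
  rewrite in_noncentral bB; apply/negP => /centP/(_ a aA) e1.
  by rewrite e1 ltxx in lt_ab.
have sA := fsubsetP (sub_noncentral A B); have sB := fsubsetP (sub_noncentral B A).
set U := fset_mul (noncentral A B) [fset b] `|` fset_mul (noncentral B A) [fset a].
have cardU : #|` U| = (#|` noncentral A B| + #|` noncentral B A|)%N.
  rewrite cardfsU_disjoint ?card_fset_mul1r // => _ /fset_mulP[x [_ [xA /fset1P-> ->]]].
  move=> /fset_mulP[y [_ [yB /fset1P-> e1]]].
  have : a * b < x * b.
    by rewrite e1; apply: (lt_le_trans lt_ab); rewrite ler_mulg2r min_b ?sB.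
  by rewrite ltr_mulg2r ltNge max_a ?sA.
have sUW : U `<=` W by apply: fsetUSS; apply: fset_mulS; rewrite ?fsub1set.
split=> [|leW]; first by rewrite -cardU fsubset_leq_card.
rewrite leqNgt; apply/negP => BB.
have eW : W = U by apply/esym/eqP; rewrite eqEfcard sUW cardU.
have B2 : (1 < #|` B|)%N by lia.
have [x0 [u [u1 cu x0B prog down]]] := fset_sqr_small_progression cB B2 BB.
have cX x i : x \in B -> x * u ^+ i = u ^+ i * x.
  by move=> xB; apply/commuteX/esym/(centP _ _ cu).
have x0b : x0 = b.
  apply/le_anti; rewrite min_b // andbT; have [i ->] := prog b bB.
  by rewrite cX // -[X in X <= _]mul1g ler_mulg2r expg_ge1.
rewrite {x0}x0b in x0B prog down.
(* A progression without gaps and with at least three terms contains its third one. *)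
have b2 : b * u ^+ 2 \in B.
  apply: contraLR B3 => nb2; rewrite -leqNgt.
  have : B `<=` [fset b; b * u].
    apply/fsubsetP => y yB; have [i yE] := prog y yB; rewrite in_fset2.
    suff : (i < 2)%N by rewrite yE; case: i {yE} => [|[|]]; rewrite // ?mulg1 ?expg1 ?eqxx ?orbT.
    rewrite ltnNge; apply: contra nb2 => le2i; move: yB; rewrite yE -(subnKC le2i).
    elim: (i - 2)%N => [|k IH]; first by rewrite addn0.
    by rewrite addnS => /down.
  by move=> /fsubset_leq_card/leq_trans; apply; rewrite cardfs2; case: (_ != _).
have b1 := down _ b2; rewrite expg1 in b1.
(* If [a * (b * u ^+ j)] were in A0 b, then [a * u ^+ j] would be an element of [A] above its
   maximum [a]; so it is in B0 a. *)
have H j : (0 < j)%N -> b * u ^+ j \in B -> exists i, a * (b * u ^+ j) = b * u ^+ i * a.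
  move=> j0 bj; have [/centP cbj|nbj] := boolP (cent A (b * u ^+ j)).
    by exists j; rewrite cbj.
  have : a * (b * u ^+ j) \in U.
    by rewrite -eW; apply/fsetUP; left; rewrite mem_fset_mul // in_noncentral bj.
  case/fsetUP => /fset_mulP[x [_ [xU /fset1P-> E]]]; last first.
    by have [i xE] := prog x (sB _ xU); exists i; rewrite E xE.
  have {}E : a * u ^+ j = x by apply: (mulIg b); rewrite -E -mulgA cX.
  have cuA : cent A (u ^+ j).
    have := cent_self cA (sA _ xU); rewrite -E cent_mull //; exact: cent_self.
  have := max_a _ (sA _ xU).
  by rewrite -E -(centP _ _ cuA) // leNgt ltr_pmulg expg_gt1.
have [i e1] := H 1%N isT b1; have [j e2] := H 2 isT b2.
rewrite expg1 in e1.
exact: square_eq_absurd u1 (esym (centP _ _ cu b bB)) eab lt_ab e1 e2.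
Qed.

(** * The final count *)

Lemma small_square_commute A B :
    {in A &, commutative *%g} -> {in B &, commutative *%g} ->
    (forall x y, x \in A -> y \in B -> x < y) ->
    (forall x y, x \in fset_mul A A -> y \in fset_mul B B -> x <= y) ->
    (4 <= #|` A|)%N -> (3 <= #|` B|)%N ->
    (#|` fset_mul (A `|` B) (A `|` B)| <= 3 * #|` A `|` B| - 3)%N ->
  forall x y, x \in A -> y \in B -> x * y = y * x.
Proof.
move=> cA cB ltAB leAB A4 B3 AB x y xA yB; apply: contrapT => nxy.
have xA0 : x \in noncentral A B.
  by rewrite in_noncentral xA; apply/negP => /centP/(_ y yB).
have yB0 : y \in noncentral B A.
  by rewrite in_noncentral yB; apply/negP => /centP/(_ x xA) /esym.
have A0 : noncentral A B != fset0 by apply/fset0Pn; exists x.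
have B0 : noncentral B A != fset0 by apply/fset0Pn; exists y.
have An0 : A != fset0 by apply/fset0Pn; exists x.
have Bn0 : B != fset0 by apply/fset0Pn; exists y.
have {AB} AB : (#|` fset_mul (A `|` B) (A `|` B)| <= 3 * (#|` A| + #|` B|) - 3)%N.
  rewrite -cardfsU_disjoint // => z zA zB.
  by have := ltAB _ _ zA zB; rewrite ltxx.
have count := card_fset_sqrU cA cB.
set W := fset_mul _ _ `|` fset_mul (noncentral B A) _ in count.
have lA := card_fset_mul An0 An0; have lB := card_fset_mul Bn0 Bn0.
have pA := card_noncentral A B; have pB := card_noncentral B A.
have lW : (#|` noncentral A B| + #|` noncentral B A| <= #|` W|.+1)%N.
  by apply: (leq_trans (card_fset_mul A0 B0)); rewrite ltnS fsubset_leq_card ?fsubsetUl.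
have lP : (#|` central B A| <=
    #|` fset_mul (noncentral A B) (central B A) `\` fset_mul A A|)%N.
  have [a aA max_a] := fset_argmax id A0; rewrite -(card_fset_mul1l a (central B A)).
  exact/fsubset_leq_card/fset_mul_noncentral_max.
have lQ : (#|` central A B| <=
    #|` fset_mul (noncentral B A) (central A B) `\` fset_mul B B|)%N.
  have [b bB min_b] := fset_argmin id B0; rewrite -(card_fset_mul1l b (central A B)).
  exact/fsubset_leq_card/fset_mul_noncentral_min.
have cardI := cardfsUI (fset_mul A A) (fset_mul B B).
have [I0|/fset0Pn[e /fsetIP[eA eB]]] := eqVneq (fset_mul A A `&` fset_mul B B) fset0;
  last first.
  have I1 : (#|` fset_mul A A `&` fset_mul B B| <= 1)%N.
    rewrite -(cardfs1 e); apply/fsubset_leq_card/fsubsetP => z /fsetIP[zA zB].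
    by rewrite in_fset1; apply/eqP/le_anti; rewrite !leAB.
  (* The common element costs one in the count, but [W] has one more than its usual minimum, so all
     bounds are attained. Then the second clause enlarges [B * B] by one, which is too much. *)
  have [lW' BB] := equal_squares_card cA cB ltAB leAB eA eB B3.
  rewrite -/W in lW' BB.
  have {}BB := BB ltac:(lia); lia.
rewrite I0 cardfs0 addn0 in cardI.
(* The improved bound 3|A| - 4 for the square of [A] brings the total to 4|A| + 3|B| - 6,
   contradicting |A| >= 4. *)
have [p1|p2] := leqP #|` noncentral A B| 1.
  have eA : noncentral A B = [fset x].
    by apply/esym/eqP; rewrite eqEfcard fsub1set xA0 cardfs1.
  have := card_fset_sqr_noncentral1 cA _ eA; lia.
(* The lower bounds now add up to exactly 3(|A| + |B|) - 3, so each of them is attained. *)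
have [q1|q2] := leqP #|` noncentral B A| 1.
  have eB : noncentral B A = [fset y].
    by apply/esym/eqP; rewrite eqEfcard fsub1set yB0 cardfs1.
  have B1 : central B A != fset0 by rewrite -cardfs_gt0; lia.
  by apply: (single_noncentral_absurd cA cB ltAB p2 eB B1); rewrite -/W; lia.
(* The other pieces leave at most |A0| + |B0| - 1 elements for [W]. *)
have W2 : (#|` W| < #|` noncentral A B| + #|` noncentral B A|)%N by lia.
apply: (noncentral_absurd xA0) => z zB.
by apply: (fset_mul_small_commute _ _ p2 q2 W2) => // s t /[1!in_noncentral]
  /andP[sX _] /[1!in_noncentral] /andP[tX _]; [apply: cA|apply: cB].
Qed.

End RightOrderedGroup.

(** * From commuting elements to the generated subgroup *)

Section Generated.
Variable G : groupType.

Lemma sub_generated (S : set G) x : S x -> generated S x.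
Proof. by move=> Sx H [_]; apply. Qed.

(** The centralizer of [x] is a subgroup containing [S]. *)
Lemma generated_commute (S : set G) (x : G) : (forall s, S s -> commute x s) ->
  forall y, generated S y -> commute x y.
Proof.
move=> cS y; apply: (_ : (generated S `<=` [set y | commute x y])%classic).
apply: smallest_sub => //=; split=> [|u v /set_mem cu /set_mem cv].
  by apply/mem_set/commute1.
by apply/mem_set/commuteM => //; apply: commuteV.
Qed.

Lemma abelian_subset_commute (S : set G) :
  (forall x y, S x -> S y -> commute x y) -> abelian_subset S.
Proof.
move=> cS; split=> [|x y Sx]; first exact: generated_group_closed.
apply: generated_commute => s Ss; apply/commute_sym.
by apply: generated_commute Sx => t; apply: cS.
Qed.

End Generated.

Theorem theorem2p10 (d : Order.disp_t) (G : rightOrderedGroupType d)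
    (A B : {fset G})
    (A_neq0 : A != fset0) (B_neq0 : B != fset0)
    (abA : abelian_subset [set` A]) (abB : abelian_subset [set` B])
    (ltAB : (fset_max A < fset_min B)%O)
    (leAB2 : (fset_max (fset_sqr A) <= fset_min (fset_sqr B))%O)
    (cardA : (4 <= #|` A|)%N) (cardB : (3 <= #|` B|)%N)
    (cardAB2 : (#|` fset_sqr (A `|` B)| = 3 * #|` A `|` B| - 3)%N) :
  abelian_subgroup (generated [set` A `|` B]).
Proof.
have ab (X : {fset G}) : abelian_subset [set` X] -> {in X &, commutative *%g}.
  by move=> [_ cX] x y xX yX; apply: cX; apply: sub_generated.
have [cA cB] := (ab _ abA, ab _ abB).
have sqr_neq0 (X : {fset G}) : X != fset0 -> fset_sqr X != fset0.
  by case/fset0Pn => x xX; apply/fset0Pn; exists (x * x)%g; apply: mem_fset_mul.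
have le_max (X : {fset G}) x : X != fset0 -> x \in X -> (x <= fset_max X)%O.
  by move=> /fset_maxP-/(_ (fset_max X))[/(_ erefl)[_ max_x] _]; apply: max_x.
have ge_min (X : {fset G}) x : X != fset0 -> x \in X -> (fset_min X <= x)%O.
  by move=> /fset_minP-/(_ (fset_min X))[/(_ erefl)[_ min_x] _]; apply: min_x.
have cAB : forall x y, x \in A -> y \in B -> (x * y = y * x)%g.
  apply: small_square_commute => //; last by rewrite -cardAB2.
    move=> x y xA yB; apply: Order.POrderTheory.le_lt_trans (le_max _ _ A_neq0 xA) _.
    exact: Order.POrderTheory.lt_le_trans ltAB (ge_min _ _ B_neq0 yB).
  move=> x y xA yB.
  apply: Order.POrderTheory.le_trans (le_max _ _ (sqr_neq0 _ A_neq0) xA) _.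
  exact: Order.POrderTheory.le_trans leAB2 (ge_min _ _ (sqr_neq0 _ B_neq0) yB).
apply: abelian_subset_commute => x y /= /fsetUP[xA|xB] /fsetUP[yA|yB].
- exact: cA.
- exact: cAB.
- by apply/commute_sym/cAB.
- exact: cB.
Qed.
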